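(* Let $H,K\in M_n(\mathbb{C})$ be Hermitian and $1\le t\le 2$. Then $$e^{(1-t)H/2}e^{tK}e^{(1-t)H/2}\prec_{(\log)} e^H\#_te^K.$$
   Context: For positive definite $X,Y$ and $t\in\mathbb{R}$, $X\#_tY:=X^{1/2}(X^{-1/2}YX^{-1/2})^tX^{1/2}$. For $A,B\in M_n(\mathbb{C})$ with singular values $s_1(A)\ge\dots\ge s_n(A)$ and $s_1(B)\ge\dots\ge s_n(B)$, write $A\prec_{(\log)}B$ if $\prod_{i=1}^k s_i(A)\le\prod_{i=1}^k s_i(B)$ for $1\le k\le n$, with equality for $k=n$. *)

(* Defs.v *)
From Stdlib Require Import Reals ClassicalEpsilon Factorial.
Open Scope R_scope.

Record C := mkC { re : R; im : R }.
Definition C0 : C := mkC 0 0.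
Definition C1 : C := mkC 1 0.
Definition RtoC (r : R) : C := mkC r 0.
Definition Cadd (x y : C) : C := mkC (re x + re y) (im x + im y).
Definition Cmul (x y : C) : C :=
  mkC (re x * re y - im x * im y) (re x * im y + im x * re y).
Definition Cconj (x : C) : C := mkC (re x) (- im x).

Fixpoint Csum (k : nat) (f : nat -> C) : C :=
  match k with O => C0 | S k' => Cadd (Csum k' f) (f k') end.

(* ---------- n x n complex matrices (entries outside range ignored) ---------- *)
Definition Mat := nat -> nat -> C.
Definition mzero : Mat := fun _ _ => C0.
Definition mid : Mat := fun i j => if Nat.eqb i j then C1 else C0.
Definition mmul (n : nat) (A B : Mat) : Mat :=
  fun i j => Csum n (fun k => Cmul (A i k) (B k j)).
Definition madj (A : Mat) : Mat := fun i j => Cconj (A j i).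
Definition mscale (r : R) (A : Mat) : Mat := fun i j => Cmul (RtoC r) (A i j).
Definition madd (A B : Mat) : Mat := fun i j => Cadd (A i j) (B i j).
Definition mdiag (d : nat -> R) : Mat :=
  fun i j => if Nat.eqb i j then RtoC (d i) else C0.
Definition meq (n : nat) (A B : Mat) : Prop :=
  forall i j, (i < n)%nat -> (j < n)%nat -> A i j = B i j.

Definition hermitian (n : nat) (H : Mat) : Prop := meq n (madj H) H.
Definition unitary (n : nat) (U : Mat) : Prop := meq n (mmul n (madj U) U) mid.

Fixpoint mpow (n : nat) (A : Mat) (k : nat) : Mat :=
  match k with O => mid | S k' => mmul n (mpow n A k') A end.

Fixpoint expsum (n : nat) (A : Mat) (N : nat) : Mat :=
  match N with
  | O => mid
  | S N' => madd (expsum n A N') (mscale (/ INR (fact N)) (mpow n A N))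
  end.

Definition mexp (n : nat) (A : Mat) : Mat :=
  epsilon (inhabits mzero) (fun M =>
    forall i j, (i < n)%nat -> (j < n)%nat ->
      Un_cv (fun N => re (expsum n A N i j)) (re (M i j)) /\
      Un_cv (fun N => im (expsum n A N i j)) (im (M i j))).

Definition spectral (n : nat) (H U : Mat) (d : nat -> R) : Prop :=
  unitary n U /\ meq n H (mmul n (mmul n U (mdiag d)) (madj U)).

Definition matfun (n : nat) (f : R -> R) (H : Mat) : Mat :=
  let p := epsilon (inhabits (mzero, fun _ : nat => 0))
             (fun p : Mat * (nat -> R) => spectral n H (fst p) (snd p)) in
  mmul n (mmul n (fst p) (mdiag (fun i => f (snd p i)))) (madj (fst p)).

Definition mrpow (n : nat) (X : Mat) (r : R) : Mat :=
  matfun n (fun x => Rpower x r) X.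

Definition gmean (n : nat) (t : R) (X Y : Mat) : Mat :=
  let Xh := mrpow n X (1/2) in
  let Xmh := mrpow n X (-(1/2)) in
  mmul n (mmul n Xh (mrpow n (mmul n (mmul n Xmh Y) Xmh) t)) Xh.

(* s_1 >= ... >= s_n: square roots of the eigenvalues of A^* A, in
   nonincreasing order; index i (0-based) gives s_{i+1}(A). *)
Definition singvals (n : nat) (A : Mat) : nat -> R :=
  let p := epsilon (inhabits (mzero, fun _ : nat => 0))
             (fun p : Mat * (nat -> R) =>
                spectral n (mmul n (madj A) A) (fst p) (snd p) /\
                (forall i j, (i <= j)%nat -> (j < n)%nat -> snd p j <= snd p i)) in
  fun i => sqrt (snd p i).

Fixpoint Rprod (k : nat) (f : nat -> R) : R :=
  match k with O => 1 | S k' => Rprod k' f * f k' end.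

Definition logmaj (n : nat) (A B : Mat) : Prop :=
  (forall k, (1 <= k <= n)%nat -> Rprod k (singvals n A) <= Rprod k (singvals n B)) /\
  Rprod n (singvals n A) = Rprod n (singvals n B).

(* Main.v *)
(** For an invertible matrix [X] let [Phi_k X] be the product of its [k] largest
    singular values. Its square is the maximum of
    [det (V^* X^* X V) / det (V^* V)] over [n x k] matrices [V], so [Phi_k] is
    submultiplicative; moreover [Phi_k X^* = Phi_k X] and
    [Phi_k (P^s) = (Phi_k P)^s] for [P] positive definite and [0 <= s]. These
    properties alone give the Cordes inequality
    [Phi_k (P^s Q^s) <= Phi_k (P Q)^s] for [0 <= s <= 1], as for the operator norm.

    Put [A = e^H], [B = e^K], [r = t - 1], [C = A^(-1/2) B A^(-1/2)],
    [D = C^(1/2) A C^(1/2)] and [X = A^(1/2) C^(t/2)]. The geometric mean is [X X^*].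
    From [(Y Y^* )^t = Y (Y^* Y)^r Y^*] for [Y = A^(1/2) C^(1/2)], the left-hand side
    is [Z^* Z] with
    [Z = D^(r/2) C^(1/2) A^((1-r)/2)
       = (D^(r/2) C^(r^2/2)) (C^((1-r)t/2) A^((1-r)/2))].
    The Cordes inequality bounds the two factors by [Phi_k X ^ r] and
    [Phi_k X ^ (1-r)], because [Phi_k (D^(1/2) C^(r/2)) = Phi_k X]. For [k = n],
    [Phi_n] is the modulus of the determinant, hence multiplicative. *)

Require Import Defs.
From Stdlib Require Import Reals ClassicalEpsilon.
From mathcomp Require Import all_boot all_order all_fingroup all_algebra complex Rstruct.
From mathcomp Require Import ring lra.
Set Implicit Arguments.
Unset Strict Implicit.
Unset Printing Implicit Defensive.
Import Order.TTheory GRing.Theory Num.Theory.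
Local Open Scope ring_scope.
Local Open Scope sesquilinear_scope.
#[local] Bind Scope ring_scope with R.
#[local] Arguments exp x%_ring_scope.
#[local] Arguments ln x%_ring_scope.
#[local] Arguments sqrt x%_ring_scope.

(** * Determinants of compressions *)

(** Induction on [#|S|], removing the largest index [x] of [S]: the other [m] elements are smaller
    than [x], so [m <= x] and [d x <= d m]. *)
Lemma prod_le_prefix (F : numDomainType) n (d : nat -> F) (S : {set 'I_n}) :
  (forall i, (i < n)%N -> 0 <= d i) ->
  (forall i j, (i <= j)%N -> (j < n)%N -> d j <= d i) ->
  \prod_(i in S) d i <= \prod_(i < #|S|) d i.
Proof.
move=> d_ge0 d_anti; have [m cS] : exists m, #|S| = m by exists #|S|.
rewrite cS; elim: m S cS => [|m IHm] S cS.
  by move/eqP: cS; rewrite cards_eq0 => /eqP ->; rewrite big_set0 big_ord0.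
have /card_gt0P[i0 i0S] : (0 < #|S|)%N by rewrite cS.
case: (@arg_maxnP _ i0 (mem S) (fun i => val i) i0S) => x xS x_max.
move: xS; rewrite inE /= => xS.
have cSx : #|S :\ x| = m by move: cS; rewrite (cardsD1 x) xS => -[].
have m_le_x : (m <= x)%N.
  rewrite -cSx cardE -(size_map val) -[leqRHS](size_iota 0).
  apply: uniq_leq_size; first by rewrite map_inj_uniq ?enum_uniq //; apply: val_inj.
  move=> _ /mapP[y + ->]; rewrite mem_enum in_setD1 mem_iota add0n /= => /andP[yx yS].
  by rewrite ltn_neqAle yx; apply: x_max.
rewrite (big_setD1 x) //= big_ord_recr /= mulrC ler_pM //.
- by apply: prodr_ge0 => i _; apply: d_ge0.
- exact: d_ge0.
- exact: IHm.
- exact: d_anti.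
Qed.

(** Distributivity in each Leibniz term selects one summation index per row, that is, a map [f]; the
    remaining sum over permutations is the determinant of the rows of [B] selected by [f]. *)
Lemma det_mulmx_rowsub (R : comNzRingType) k n (A : 'M[R]_(k, n)) (B : 'M_(n, k)) :
  \det (A *m B) =
    \sum_(f : {ffun 'I_k -> 'I_n}) (\prod_i A i (f i)) * \det (mxsub f id B).
Proof.
rewrite /determinant.
under eq_bigr => s _.
  under eq_bigr => i _ do rewrite mxE.
  rewrite bigA_distr_bigA mulr_sumr; over.
rewrite exchange_big; apply: eq_bigr => f _; rewrite mulr_sumr.
apply: eq_bigr => s _; rewrite big_split mulrCA; congr (_ * (_ * _)).
by apply: eq_bigr => i _; rewrite mxE.
Qed.

Section NumClosed.
Variable C : numClosedFieldType.

(* Cauchy-Binet summed over all maps instead of [k]-subsets: each subset occurs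
   [k!] times and the non-injective maps contribute [0]. *)
Lemma det_gram_diag k n (w : 'rV[C]_n) (V : 'M[C]_(n, k)) :
  k`!%:R * \det (V ^t* *m diag_mx w *m V) =
    \sum_(f : {ffun 'I_k -> 'I_n})
      (\prod_i w 0 (f i)) * `|\det (mxsub f id V)| ^+ 2.
Proof.
(* Reindexing the maps by each permutation [s] gives [k!] expressions of the same determinant; their
   sum over [s] assembles the conjugate of the second determinant. *)
pose h (s : 'S_k) (f : {ffun 'I_k -> 'I_n}) := [ffun i => f (s i)].
have h_bij s : bijective (h s).
  by exists (h s^-1%g) => f; apply/ffunP => i; rewrite !ffunE ?permK ?permKV.
have detE (s : 'S_k) : \det (V ^t* *m diag_mx w *m V) =
    \sum_(f : {ffun 'I_k -> 'I_n})
     (\prod_i w 0 (f i)) * (((-1) ^+ s * \prod_i (V (f (s i)) i)^*)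
         * \det (mxsub f id V)).
  rewrite det_mulmx_rowsub (reindex (h s)); last exact: onW_bij.
  apply: eq_bigr => f _.
  have -> : mxsub (h s f) id V = row_perm s (mxsub f id V).
    by apply/matrixP => i j; rewrite !mxE ffunE.
  rewrite row_permE det_mulmx det_perm.
  have -> : \prod_i (V ^t* *m diag_mx w) i (h s f i) =
      (\prod_i w 0 (f i)) * \prod_i (V (f (s i)) i)^*.
    rewrite [X in X * _](reindex_inj (@perm_inj _ s)) -big_split /=; apply: eq_bigr => i _.
    by rewrite mul_mx_diag !mxE ffunE mulrC.
  by rewrite -!mulrA; congr (_ * _); rewrite mulrCA.
transitivity (\sum_(s : 'S_k) \det (V ^t* *m diag_mx w *m V)).
  by rewrite sumr_const card_Sn mulr_natl.
under eq_bigr => s _ do rewrite (detE s).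
rewrite exchange_big; apply: eq_bigr => f _; rewrite -mulr_sumr; congr (_ * _).
rewrite -mulr_suml normCK mulrC -det_tr -det_map_mx; congr (_ * _).
apply: eq_bigr => s _; congr (_ * _).
by apply: eq_bigr => i _; rewrite !mxE.
Qed.

(** Both sides are expanded with [det_gram_diag], the right one with weights 1, and compared map by
    map: a non-injective map repeats a row and contributes 0, an injective one falls under
    [prod_le_prefix]. *)
Lemma det_gram_le k n (d : nat -> C) (V : 'M[C]_(n, k)) :
  (forall i, (i < n)%N -> 0 <= d i) ->
  (forall i j, (i <= j)%N -> (j < n)%N -> d j <= d i) ->
  \det (V ^t* *m diag_mx (\row_i d i) *m V) <=
    (\prod_(i < k) d i) * \det (V ^t* *m V).
Proof.
move=> d_ge0 d_anti.
have kgt0 : 0 < k`!%:R :> C by rewrite ltr0n fact_gt0.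
rewrite -(ler_pM2l kgt0) mulrCA det_gram_diag.
have -> : V ^t* *m V = V ^t* *m diag_mx (const_mx 1) *m V.
  by rewrite diag_const_mx mulmx1.
rewrite det_gram_diag mulr_sumr; apply: ler_sum => f _.
have -> : \prod_i (const_mx 1 : 'rV[C]_n) 0 (f i) = 1.
  by apply: big1 => i _; rewrite mxE.
have -> : \prod_i (\row_j d j) 0 (f i) = \prod_i d (f i).
  by apply: eq_bigr => i _; rewrite mxE.
rewrite mul1r.
have [f_inj|/injectivePn[i [j ij fij]]] := boolP (injectiveb f); last first.
  rewrite (determinant_alternate ij) ?normr0 ?expr0n ?mulr0 // => l.
  by rewrite !mxE fij.
apply: ler_wpM2r; first by rewrite exprn_ge0.
have := @prod_le_prefix _ _ d (f @: 'I_k) d_ge0 d_anti.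
rewrite card_imset ?card_ord; last exact/injectiveP.
rewrite big_imset /=; last by move=> i j _ _; apply/injectiveP.
exact.
Qed.

End NumClosed.

(** * Exponentials and midpoint convexity *)

Definition antitone_below n (d : nat -> R) :=
  forall i j : nat, (i <= j)%N -> (j < n)%N -> d j <= d i.

Lemma expD (x y : R) : exp (x + y) = exp x * exp y.
Proof. exact: exp_plus. Qed.

Lemma exp0 : exp 0 = 1.
Proof. exact: exp_0. Qed.

Lemma exp_sum k (d : nat -> R) : \prod_(i < k) exp (d i) = exp (\sum_(i < k) d i).
Proof.
apply: (big_rec2 (fun x y : R => x = exp y)); first by rewrite exp0.
by move=> i x y _ ->; rewrite -expD.
Qed.

Lemma sqrt_exp x : sqrt (exp x) = exp (x / 2).
Proof.
have {1}-> : x = x / 2 + x / 2 by lra.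
by rewrite expD sqrt_square //; apply/Rlt_le/exp_pos.
Qed.

Lemma le_exp x y : (exp x <= exp y) = (x <= y).
Proof.
apply/idP/idP => [/RleP xy | /RleP[xy | ->]] //; last exact/RleP/Rlt_le/exp_increasing.
rewrite leNgt; apply/negP => /RltP/exp_increasing/RltP.
by rewrite ltNge; move/negP; apply; apply/RleP.
Qed.

(* Comparing [s] with the midpoint of [0, 2s] or of [2s - 1, 1] halves any upper bound
   of the gap to the chord, so boundedness replaces continuity. *)
Lemma midconvex_le_chord (f : R -> R) M :
  (forall s u, f ((s + u) / 2) <= (f s + f u) / 2) -> f 0 <= 0 ->
  (forall s, 0 <= s <= 1 -> f s <= M) ->
  forall s, 0 <= s <= 1 -> f s <= s * f 1.
Proof.
move=> f_mid f0 f_le.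
have [B B_ge0 fB] : exists2 B, 0 <= B & forall s, 0 <= s <= 1 -> f s - s * f 1 <= B.
  exists (`|M| + `|f 1|) => [|s s01]; first by rewrite addr_ge0.
  have := f_le _ s01; have := ler_norm M.
  have : - (s * f 1) <= `|f 1|.
    rewrite (le_trans (ler_norm _)) // normrN normrM ger0_norm; last lra.
    by rewrite ler_piMl //; lra.
  lra.
have fBn m s : 0 <= s <= 1 -> f s - s * f 1 <= B / 2 ^+ m.
  elim: m s => [|m IHm] s s01; first by rewrite expr0 divr1 fB.
  rewrite exprS invfM mulrCA; have [s_le | s_gt] := lerP s (1 / 2).
    have := f_mid 0 (2 * s); have -> : (0 + 2 * s) / 2 = s by lra.
    have /IHm : 0 <= 2 * s <= 1 by lra.
    lra.
  have := f_mid (2 * s - 1) 1; have -> : (2 * s - 1 + 1) / 2 = s by lra.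
  have /IHm : 0 <= 2 * s - 1 <= 1 by lra.
  have : 0 <= B / 2 ^+ m by rewrite divr_ge0 ?exprn_ge0.
  lra.
move=> s s01; rewrite leNgt -subr_gt0; apply/negP => gap.
(* Since [m < 2 ^ m], this [m] pushes [B / 2 ^ m] below the gap. *)
have [m Bm] : exists m : nat, B / (f s - s * f 1) < m%:R.
  by exists (Num.bound (B / (f s - s * f 1))); rewrite archi_boundP // divr_ge0 // ltW.
have := fBn m s s01; rewrite leNgt => /negP; apply.
rewrite ltr_pdivrMr ?exprn_gt0 // mulrC -ltr_pdivrMr //; apply: lt_trans Bm _.
by rewrite -natrX ltr_nat ltn_expl.
Qed.

(** * Adjoints and unitary matrices *)

Section Adjoint.
Variable C : numClosedFieldType.

Lemma adjM m n p (A : 'M[C]_(m, n)) (B : 'M[C]_(n, p)) :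
  (A *m B) ^t* = B ^t* *m A ^t*.
Proof. by rewrite trmx_mul map_mxM. Qed.

Lemma adj1 n : (1%:M : 'M[C]_n) ^t* = 1%:M.
Proof. by rewrite trmx1 map_mx1. Qed.

Lemma unitary_mulVmx n (U : 'M[C]_n) : U \is unitarymx -> U ^t* *m U = 1%:M.
Proof. by move=> /unitarymxP /mulmx1C. Qed.

Lemma unitmx_adj n (X : 'M[C]_n) : (X ^t* \in unitmx) = (X \in unitmx).
Proof. by rewrite map_unitmx unitmx_tr. Qed.

End Adjoint.

(** * Spectral calculus *)

(** Identifies [R] with the real elements of [K], so that eigenvalues of Hermitian matrices can be
    passed to [exp], [ln] and [Rpower]. *)
Definition real_embedding (K : numClosedFieldType) (rc : R -> K) :=
  [/\ forall x y, (rc x <= rc y) = (x <= y), forall x, (rc x)^* = rc x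
    & forall z, z \is Num.real -> exists x, z = rc x].

Section SpectralCalculus.
Variables (K : numClosedFieldType) (rc : {rmorphism R -> K}).
Hypothesis rcP : real_embedding rc.
Variable n : nat.
Implicit Types (d e : nat -> R) (P Q S U V X Y Z : 'M[K]_n) (s u t : R).

Lemma rc_le x y : (rc x <= rc y) = (x <= y).
Proof. by case: rcP. Qed.

Lemma rc_ge0 x : (0 <= rc x) = (0 <= x).
Proof. by rewrite -(rmorph0 rc) rc_le. Qed.

Lemma rc_conj x : (rc x)^* = rc x.
Proof. by case: rcP. Qed.

Definition rdiag k d : 'M[K]_k := diag_mx (\row_i rc (d i)).

Definition specmx U d := U *m rdiag n d *m U ^t*.

Lemma eq_rdiag d e : (forall i, (i < n)%N -> d i = e i) -> rdiag n d = rdiag n e.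
Proof. by move=> de; congr diag_mx; apply/rowP => i; rewrite !mxE de. Qed.

Lemma rdiagM d e : rdiag n d *m rdiag n e = rdiag n (fun i => d i * e i).
Proof.
rewrite mulmx_diag; congr diag_mx; apply/rowP => i.
by rewrite !mxE rmorphM.
Qed.

Lemma rdiag1 : rdiag n (fun=> 1) = 1%:M.
Proof.
by rewrite -diag_const_mx; congr diag_mx; apply/rowP => i; rewrite !mxE rmorph1.
Qed.

Lemma rdiag_adj d : (rdiag n d) ^t* = rdiag n d.
Proof.
rewrite tr_diag_mx map_diag_mx; congr diag_mx.
by apply/rowP => i; rewrite !mxE; apply: rc_conj.
Qed.

Lemma det_rdiag k d : \det (rdiag k d) = rc (\prod_(i < k) d i).
Proof.
by rewrite det_diag rmorph_prod; apply: eq_bigr => i _; rewrite mxE.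
Qed.

Lemma specmx_adj U d : (specmx U d) ^t* = specmx U d.
Proof. by rewrite /specmx !adjM trmxCK rdiag_adj mulmxA. Qed.

Lemma specmxM U d e : U \is unitarymx ->
  specmx U d *m specmx U e = specmx U (fun i => d i * e i).
Proof.
by move=> uU; rewrite /specmx -rdiagM !mulmxA mulmxKtV.
Qed.

Lemma specmxD U d e : specmx U d + specmx U e = specmx U (fun i => d i + e i).
Proof.
rewrite /specmx -mulmxDl -mulmxDr; congr (_ *m _ *m _).
by rewrite -raddfD; congr diag_mx; apply/rowP => i; rewrite !mxE rmorphD.
Qed.

Lemma specmxZ U s d : rc s *: specmx U d = specmx U (fun i => s * d i).
Proof.
rewrite /specmx scalemxAl scalemxAr; congr (_ *m _ *m _).
by rewrite -linearZ; congr diag_mx; apply/rowP => i; rewrite !mxE rmorphM.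
Qed.

Lemma specmx1 U : U \is unitarymx -> specmx U (fun=> 1) = 1%:M.
Proof. by move=> uU; rewrite /specmx rdiag1 mulmx1; apply/unitarymxP. Qed.

Lemma eq_specmx U d e : (forall i, (i < n)%N -> d i = e i) -> specmx U d = specmx U e.
Proof. by move=> de; rewrite /specmx (eq_rdiag de). Qed.

Lemma det_specmx U d : U \is unitarymx ->
  \det (specmx U d) = rc (\prod_(i < n) d i).
Proof.
move=> uU; rewrite /specmx !det_mulmx mulrAC -det_mulmx.
by rewrite (unitarymxP uU) det1 mul1r det_rdiag.
Qed.

(** The matrix [W = V^* U] intertwines the two diagonals, so a nonzero entry [W i j] forces
    [e i = d j]; hence [W] also intertwines their images under any [f]. *)
Lemma specmx_fun_uniq (f : R -> R) U V d e : U \is unitarymx -> V \is unitarymx ->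
  specmx U d = specmx V e ->
  specmx U (fun i => f (d i)) = specmx V (fun i => f (e i)).
Proof.
move=> uU uV eqUV; set W := V ^t* *m U.
have comm : W *m rdiag n d = rdiag n e *m W.
  have := congr1 (fun M => V ^t* *m M *m U) eqUV.
  rewrite /specmx !mulmxA unitary_mulVmx // mul1mx.
  by rewrite -!mulmxA unitary_mulVmx // mulmx1 !mulmxA.
have commf (Z : 'M_n) : Z *m rdiag n d = rdiag n e *m Z ->
    Z *m rdiag n (fun i => f (d i)) = rdiag n (fun i => f (e i)) *m Z.
  move=> commZ; apply/matrixP => i j; move/matrixP/(_ i j): commZ.
  rewrite !mul_mx_diag !mul_diag_mx !mxE.
  have [-> _|Z_neq0] := eqVneq (Z i j) 0; first by rewrite mul0r mulr0.
  by rewrite mulrC => /(mulIf Z_neq0) /fmorph_inj ->; rewrite mulrC.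
have {}commf := congr1 (fun M => V *m M *m U ^t*) (commf _ comm).
rewrite /specmx; move: commf; rewrite /W !mulmxA (unitarymxP uV) // mul1mx => ->.
by rewrite -!mulmxA (unitarymxP uU) mulmx1.
Qed.

Lemma specmx_sort U d : U \is unitarymx ->
  exists V e, [/\ V \is unitarymx, antitone_below n e & specmx V e = specmx U d].
Proof.
move=> uU; pose t := [tuple d i | i < n].
have /tuple_permP[p sort_t] : perm_eq (sort >=%R t) t by rewrite perm_sort.
pose e i := nth 0 (sort >=%R t) i; pose V := \matrix_(i, j) U i (p j).
have eE (i : 'I_n) : e i = d (p i).
  rewrite /e sort_t (nth_map i) ?size_enum_ord // nth_ord_enum.
  by rewrite tnth_map tnth_ord_tuple.
(* Stated for all [f] because two instances serve: [f = 1] gives unitarity of [V], [f = id] the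
   equality of the matrices. *)
have VE (f : R -> R) : specmx V (fun i => f (e i)) = specmx U (fun i => f (d i)).
  apply/matrixP => i l; rewrite /specmx /rdiag !mul_mx_diag !mxE.
  rewrite [RHS](reindex_inj (@perm_inj _ p)); apply: eq_bigr => j _ /=.
  by rewrite !mxE eE.
exists V, e; split.
- by apply/unitarymxP; rewrite -(specmx1 uU) -(VE (fun=> 1)) /specmx rdiag1 mulmx1.
- move=> i j ij jn; rewrite /e.
  have sz : size (sort >=%R t) = n by rewrite size_sort size_tuple.
  have ge_trans : transitive (>=%R : rel R) by move=> x y z yx zy; apply: le_trans zy yx.
  have ge_total : total (>=%R : rel R) by move=> x y; apply: le_total.
  apply: (@sorted_leq_nth _ (>=%R) ge_trans _ 0 _ (sort_sorted ge_total _)) => //.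
  - by move=> x; apply: lexx.
  - by rewrite inE sz (leq_ltn_trans ij).
  - by rewrite inE sz.
- exact: (VE id).
Qed.

Lemma hermitian_specmx P : P ^t* = P ->
  exists U d, [/\ U \is unitarymx, antitone_below n d & P = specmx U d].
Proof.
move=> hP.
have herm : P \is hermsymmx by apply/is_hermitianmxP; rewrite expr0 scale1r hP.
have /hermitian_normalmx /orthomx_spectralP PE := herm.
pose A := spectralmx P; have uA : A \is unitarymx by apply: spectral_unitarymx.
have real_sp j : exists x, spectral_diag P 0 j = rc x.
  by case: rcP => _ _; apply; apply: (mxOverP (hermitian_spectral_diag_real herm)).
have [f fE] := fin_all_exists real_sp.
pose d i := if insub i is Some j then f j else 0.
have [] := @specmx_sort (A ^t*) d; first by rewrite trmxC_unitary.
move=> V [e [uV anti_e VE]]; exists V, e; split=> //.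
rewrite VE [LHS]PE invmx_unitary // /specmx trmxCK; congr (_ *m _ *m _).
by congr diag_mx; apply/rowP => j; rewrite mxE /d valK fE.
Qed.

(** The diagonal matrix of [d] is the Gram matrix of [X U]: its diagonal entries are sums of squared
    moduli, and its determinant is nonzero. *)
Lemma specmx_gram_gt0 X U d : X \in unitmx -> U \is unitarymx ->
  X ^t* *m X = specmx U d -> forall i, (i < n)%N -> 0 < d i.
Proof.
move=> uX uU XE i i_lt_n; pose o := Ordinal i_lt_n.
have DE : (X *m U) ^t* *m (X *m U) = rdiag n d.
  rewrite adjM mulmxA -[_ *m X]mulmxA XE /specmx !mulmxA.
  by rewrite unitary_mulVmx // mul1mx -mulmxA unitary_mulVmx // mulmx1.
have d_neq0 : d i != 0.
  have : \det (rdiag n d) != 0.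
    by rewrite -DE -unitfE -unitmxE unitmx_mul unitmx_adj unitmx_mul uX unitarymx_unit.
  by rewrite det_rdiag fmorph_eq0 (bigD1 o) //= mulf_eq0 => /norP[].
rewrite lt_neqAle eq_sym d_neq0 /= -rc_ge0.
have /matrixP/(_ o o) := DE; rewrite !mxE eqxx mulr1n => <-.
by apply: sumr_ge0 => j _; rewrite !mxE mulrC mul_conjC_ge0.
Qed.

(** Eigenvalues are stored by their logarithms, so that powers become multiples of [d] and prefix
    products become sums. *)
Lemma specmx_gram_exp X : X \in unitmx ->
  exists U d, [/\ U \is unitarymx, antitone_below n d &
                  X ^t* *m X = specmx U (fun i => exp (d i))].
Proof.
move=> uX; have [|U [d [uU anti_d XE]]] := @hermitian_specmx (X ^t* *m X).
  by rewrite adjM trmxCK.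
have d_gt0 := specmx_gram_gt0 uX uU XE.
exists U, (fun i => ln (d i)); split=> //.
  move=> i j ij jn; have := anti_d i j ij jn; rewrite le_eqVlt => /orP[/eqP -> //|].
  move=> /RltP dij; apply/RleP/Rlt_le/ln_increasing => //.
  exact/RltP/d_gt0.
by rewrite XE; apply: eq_specmx => i i_n; rewrite exp_ln //; apply/RltP/d_gt0.
Qed.

(** Replacing [V] by [U^* V] reduces the bound to the diagonal case [det_gram_le]. *)
Lemma specmx_compression_le U d k (V : 'M[K]_(n, k)) : U \is unitarymx ->
  (forall i, (i < n)%N -> 0 <= d i) -> antitone_below n d ->
  \det (V ^t* *m specmx U d *m V) <= rc (\prod_(i < k) d i) * \det (V ^t* *m V).
Proof.
move=> uU d_ge0 anti_d.
have -> : V ^t* *m V = (U ^t* *m V) ^t* *m (U ^t* *m V).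
  by rewrite adjM trmxCK mulmxA -[_ *m U *m _]mulmxA (unitarymxP uU) mulmx1.
have -> : V ^t* *m specmx U d *m V = (U ^t* *m V) ^t* *m rdiag n d *m (U ^t* *m V).
  by rewrite adjM trmxCK /specmx !mulmxA.
rewrite rmorph_prod; apply: (@det_gram_le _ k n (fun i => rc (d i))).
- by move=> i i_n; rewrite rc_ge0 d_ge0.
- by move=> i j ij jn; rewrite rc_le anti_d.
Qed.

Lemma specmx_compression_eq U d k : U \is unitarymx -> (k <= n)%N ->
  exists2 V : 'M[K]_(n, k), V ^t* *m V = 1%:M &
    \det (V ^t* *m specmx U d *m V) = rc (\prod_(i < k) d i).
Proof.
(* [E] is the inclusion of the first [k] coordinates, so the columns of [U E] are the first [k]
   eigenvectors. *)
move=> uU le_kn; pose E : 'M[K]_(n, k) := \matrix_(i, j) (i == widen_ord le_kn j)%:R.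
have EE : E ^t* *m rdiag n d *m E = rdiag k d.
  apply/matrixP => i j; rewrite /rdiag mul_mx_diag !mxE.
  rewrite (bigD1 (widen_ord le_kn i)) //= !mxE eqxx conjC1 mul1r big1.
    by rewrite addr0 -val_eqE /= mulr_natr.
  by move=> l /negPf li; rewrite !mxE li conjC0 !mul0r.
have E1 : E ^t* *m E = 1%:M.
  apply/matrixP => i j; rewrite !mxE (bigD1 (widen_ord le_kn i)) //= !mxE eqxx.
  rewrite conjC1 mul1r big1 ?addr0 -?val_eqE //.
  by move=> l /negPf li; rewrite !mxE li conjC0 !mul0r.
have UU := unitary_mulVmx uU.
exists (U *m E); rewrite adjM.
  by rewrite mulmxA -(mulmxA (E ^t*) (U ^t*) U) UU mulmx1.
rewrite -(det_rdiag k d) -EE /specmx !mulmxA -(mulmxA (E ^t*) (U ^t*) U) UU mulmx1.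
by rewrite -(mulmxA (E ^t* *m rdiag n d) (U ^t*) U) UU mulmx1.
Qed.

(** Each prefix product is the maximum of [det (W^* M W)] over [W^* W = 1], which depends only on
    the matrix [M]. *)
Lemma specmx_prefix_uniq U V d e k : (k <= n)%N ->
  U \is unitarymx -> V \is unitarymx ->
  (forall i, (i < n)%N -> 0 <= d i) -> antitone_below n d ->
  (forall i, (i < n)%N -> 0 <= e i) -> antitone_below n e ->
  specmx U d = specmx V e -> \prod_(i < k) d i = \prod_(i < k) e i.
Proof.
have half (U1 V1 : 'M[K]_n) d1 e1 : (k <= n)%N ->
    U1 \is unitarymx -> V1 \is unitarymx ->
    (forall i, (i < n)%N -> 0 <= e1 i) -> antitone_below n e1 ->
    specmx U1 d1 = specmx V1 e1 -> \prod_(i < k) d1 i <= \prod_(i < k) e1 i.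
  move=> kn uU1 uV1 e1_ge0 anti_e1 UV.
  have [W W1 dE] := specmx_compression_eq d1 uU1 kn; rewrite -rc_le -dE UV.
  by apply: le_trans (specmx_compression_le _ uV1 e1_ge0 anti_e1) _; rewrite W1 det1 mulr1.
move=> kn uU uV d_ge0 anti_d e_ge0 anti_e UV.
by apply/le_anti/andP; split; [apply: half UV | apply: half (esym UV)].
Qed.

(** * Positive definite matrices and their real powers *)

Definition posdef P :=
  exists U d, U \is unitarymx /\ P = specmx U (fun i => exp (d i)).

Definition spec_pick P : 'M[K]_n * (nat -> R) :=
  epsilon (inhabits (1%:M, fun=> 0)) (fun p =>
    [/\ p.1 \is unitarymx, antitone_below n p.2 & P = specmx p.1 p.2]).

(* Locked: otherwise rewriting with [mulmx] lemmas unfolds it to a product. *)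
Fact mxpow_key : unit. Proof. exact: tt. Qed.

Definition mxpow P s := locked_with mxpow_key
  (specmx (spec_pick P).1 (fun i => Rpower ((spec_pick P).2 i) s)).

Lemma spec_pickP U d : U \is unitarymx ->
  let p := spec_pick (specmx U d) in
  [/\ p.1 \is unitarymx, antitone_below n p.2 & specmx U d = specmx p.1 p.2].
Proof.
move=> uU; have [V [e [uV anti_e VE]]] := specmx_sort d uU.
rewrite /spec_pick; set good := (fun p : 'M_n * _ => _).
by apply: (@epsilon_spec _ _ good); exists (V, e); split.
Qed.

Lemma mxpowE U d s : U \is unitarymx ->
  mxpow (specmx U (fun i => exp (d i))) s = specmx U (fun i => exp (s * d i)).
Proof.
move=> uU; have [uV _ VE] := spec_pickP (fun i => exp (d i)) uU.
rewrite /mxpow unlock -(specmx_fun_uniq (fun x => Rpower x s) uU uV VE).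
by apply: eq_specmx => i _; rewrite /Rpower ln_exp.
Qed.

Lemma posdef_mxpow P s : posdef P -> posdef (mxpow P s).
Proof.
by move=> [U [d [uU ->]]]; rewrite mxpowE //; exists U, (fun i => s * d i).
Qed.

Lemma mxpowD P s u : posdef P -> mxpow P (s + u) = mxpow P s *m mxpow P u.
Proof.
move=> [U [d [uU ->]]]; rewrite !mxpowE // specmxM //; apply: eq_specmx => i _.
by rewrite -expD -mulrDl.
Qed.

Lemma mxpowM P s u : posdef P -> mxpow (mxpow P s) u = mxpow P (s * u).
Proof.
move=> [U [d [uU ->]]]; rewrite !mxpowE //; apply: eq_specmx => i _.
by rewrite mulrCA mulrA.
Qed.

Lemma mxpow0 P : posdef P -> mxpow P 0 = 1%:M.
Proof.
move=> [U [d [uU ->]]]; rewrite mxpowE // -(specmx1 uU); apply: eq_specmx => i _.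
by rewrite mul0r exp0.
Qed.

Lemma mxpow1 P : posdef P -> mxpow P 1 = P.
Proof.
move=> [U [d [uU ->]]]; rewrite mxpowE //; apply: eq_specmx => i _.
by rewrite mul1r.
Qed.

Lemma mxpow_adj P s : posdef P -> (mxpow P s) ^t* = mxpow P s.
Proof. by move=> [U [d [uU ->]]]; rewrite mxpowE // specmx_adj. Qed.

Lemma mxpow_unit P s : posdef P -> mxpow P s \in unitmx.
Proof.
move=> pP; have : mxpow P s *m mxpow P (- s) = 1%:M by rewrite -mxpowD // subrr mxpow0.
by move/mulmx1_unit => [].
Qed.

Lemma posdef_unit P : posdef P -> P \in unitmx.
Proof. by move=> pP; rewrite -(mxpow1 pP) mxpow_unit. Qed.

Lemma posdef_sorted P : posdef P -> exists U d,
  [/\ U \is unitarymx, antitone_below n d & P = specmx U (fun i => exp (d i))].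
Proof.
move=> pP; have uh : mxpow P (1 / 2) \in unitmx by apply: mxpow_unit.
have [U [d [uU anti_d PU]]] := specmx_gram_exp uh.
exists U, d; split=> //; rewrite -PU mxpow_adj // -mxpowD //.
by rewrite -[LHS](mxpow1 pP); congr mxpow; lra.
Qed.

Lemma posdef_gram X : X \in unitmx -> posdef (X ^t* *m X).
Proof.
by move=> uX; have [U [d [uU _ XU]]] := specmx_gram_exp uX; exists U, d.
Qed.

(** The polar factor of [X] carries eigenvectors of [X^* X] to eigenvectors of [X X^*] with the same
    eigenvalues. The case [t = 1] diagonalises [X X^*]; general [t] gives its powers. *)
Lemma gram_swap X U d : U \is unitarymx ->
  X ^t* *m X = specmx U (fun i => exp (d i)) ->
  exists2 V, V \is unitarymx & forall t,
    specmx V (fun i => exp (t * d i)) =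
      X *m specmx U (fun i => exp ((t - 1) * d i)) *m X ^t*.
Proof.
(* [W] is [(X^* X)^(-1/2)], so [X W] is the unitary polar factor and [V = X W U]. *)
move=> uU XU; pose W := specmx U (fun i => exp (- (1 / 2) * d i)).
have WXW : W *m (X ^t* *m X) *m W = 1%:M.
  rewrite XU !specmxM // -(specmx1 uU); apply: eq_specmx => i _.
  by rewrite -!expD -[RHS]exp0; congr exp; lra.
have hW : W ^t* = W by apply: specmx_adj.
exists (X *m W *m U).
  apply/unitarymxP/mulmx1C; rewrite (adjM (X *m W)) (adjM X) hW.
  have -> : U ^t* *m (W *m X ^t*) *m (X *m W *m U) =
      U ^t* *m (W *m (X ^t* *m X) *m W) *m U by rewrite !mulmxA.
  by rewrite WXW mulmx1 unitary_mulVmx.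
move=> t.
have -> : specmx U (fun i => exp ((t - 1) * d i)) =
    W *m specmx U (fun i => exp (t * d i)) *m W.
  rewrite !specmxM //; apply: eq_specmx => i _.
  by rewrite -!expD; congr exp; lra.
by rewrite /specmx (adjM (X *m W)) (adjM X) hW !mulmxA.
Qed.

Lemma mxpow_gram X t : X \in unitmx ->
  mxpow (X *m X ^t*) t = X *m mxpow (X ^t* *m X) (t - 1) *m X ^t*.
Proof.
move=> uX; have [U [d [uU _ XU]]] := specmx_gram_exp uX.
have [V uV VE] := gram_swap uU XU.
rewrite XU mxpowE // -VE -mxpowE //; congr mxpow.
have -> : specmx V (fun i => exp (d i)) = specmx V (fun i => exp (1 * d i)).
  by apply: eq_specmx => i _; rewrite mul1r.
rewrite VE -[X in X *m _]mulmx1 -(specmx1 uU); congr (_ *m _ *m _).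
by apply: eq_specmx => i _; rewrite subrr mul0r exp0.
Qed.

(** * Products of singular values *)

Lemma ln_prod k (f : nat -> R) : (forall i, (i < k)%N -> 0 < f i) ->
  \sum_(i < k) ln (f i) = ln (\prod_(i < k) f i).
Proof.
elim: k => [|k IHk] f_gt0; first by rewrite !big_ord0 ln_1.
rewrite !big_ord_recr IHk => [|i ik]; last by apply: f_gt0; apply: ltnW.
rewrite [RHS]ln_mult //; apply/RltP; last exact: f_gt0.
by apply: prodr_gt0 => i _; apply: f_gt0; apply: ltnW (ltn_ord i).
Qed.

Lemma antitone_exp d : antitone_below n d -> antitone_below n (fun i => exp (d i)).
Proof. by move=> anti_d i j ij jn; rewrite le_exp anti_d. Qed.

Lemma exp_gt0 x : 0 < exp x.
Proof. exact/RltP/exp_pos. Qed.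

Lemma double_half (x : R) : 2 * (x / 2) = x.
Proof. lra. Qed.

(* Logarithm of the product of the [k] largest singular values of [X] (invertible). *)
Definition lphi k X : R := (\sum_(i < k) ln ((spec_pick (X ^t* *m X)).2 i)) / 2.

(** The sum of logarithms is the logarithm of a prefix product, which [specmx_prefix_uniq] makes
    independent of the sorted diagonalisation. *)
Lemma lphiE k X U d : (k <= n)%N -> X \in unitmx -> U \is unitarymx ->
  antitone_below n d -> X ^t* *m X = specmx U (fun i => exp (d i)) ->
  lphi k X = (\sum_(i < k) d i) / 2.
Proof.
move=> kn uX uU anti_d XU.
have := spec_pickP (fun i => exp (d i)) uU; rewrite -XU => -[uV anti_e XV].
rewrite /lphi.
have e_gt0 := specmx_gram_gt0 uX uV XV.
rewrite ln_prod => [|i ik]; last exact/e_gt0/(leq_trans ik).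
rewrite -(ln_exp (\sum_(i < k) d i)) -exp_sum; congr (ln _ / _).
apply: (specmx_prefix_uniq kn uV uU _ anti_e _ (antitone_exp anti_d)).
- by move=> i i_n; apply/ltW/e_gt0.
- by move=> i _; apply/ltW/exp_gt0.
- by rewrite -XV.
Qed.

Section LogNorm.
Variable k : nat.
Hypothesis kn : (k <= n)%N.

Lemma lphi_max X (V : 'M_(n, k)) : X \in unitmx ->
  \det ((X *m V) ^t* *m (X *m V)) <= rc (exp (2 * lphi k X)) * \det (V ^t* *m V).
Proof.
move=> uX; have [U [d [uU anti_d XU]]] := specmx_gram_exp uX.
rewrite (lphiE kn uX uU anti_d XU) double_half -exp_sum adjM.
rewrite -mulmxA (mulmxA (X ^t*)) XU mulmxA.
apply: specmx_compression_le => //; last exact: antitone_exp.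
by move=> i _; apply/ltW/exp_gt0.
Qed.

Lemma lphi_attained X : X \in unitmx ->
  exists2 V : 'M_(n, k), V ^t* *m V = 1%:M &
    \det ((X *m V) ^t* *m (X *m V)) = rc (exp (2 * lphi k X)).
Proof.
move=> uX; have [U [d [uU anti_d XU]]] := specmx_gram_exp uX.
rewrite (lphiE kn uX uU anti_d XU) double_half -exp_sum.
have [V V1 VE] := specmx_compression_eq (fun i => exp (d i)) uU kn; exists V => //.
by rewrite -VE -XU adjM !mulmxA.
Qed.

(** Take [V] extremal for [X Y] and apply the variational bound first to [X] at [Y V], then to [Y]
    at [V]. *)
Lemma lphiM X Y : X \in unitmx -> Y \in unitmx ->
  lphi k (X *m Y) <= lphi k X + lphi k Y.
Proof.
move=> uX uY; have uXY : X *m Y \in unitmx by rewrite unitmx_mul uX.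
have [V V1 VE] := lphi_attained uXY.
suff : exp (2 * lphi k (X *m Y)) <= exp (2 * lphi k X + 2 * lphi k Y).
  by rewrite le_exp; lra.
rewrite expD -rc_le -VE rmorphM -mulmxA (le_trans (lphi_max _ uX)) //.
rewrite ler_wpM2l ?rc_ge0 ?(ltW (exp_gt0 _)) //.
by rewrite (le_trans (lphi_max _ uY)) // V1 det1 mulr1.
Qed.

(** By [gram_swap] at [t = 1], [X X^*] has the same sorted exponents as [X^* X]. *)
Lemma lphi_adj X : X \in unitmx -> lphi k (X ^t*) = lphi k X.
Proof.
move=> uX; have [U [d [uU anti_d XU]]] := specmx_gram_exp uX.
have [V uV /(_ 1) VE] := gram_swap uU XU.
rewrite (lphiE kn uX uU anti_d XU) (@lphiE k _ V d) // ?unitmx_adj //.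
rewrite trmxCK -[X in X *m _]mulmx1 -(specmx1 uU).
have -> : specmx U (fun=> 1) = specmx U (fun i => exp ((1 - 1) * d i)).
  by apply: eq_specmx => i _; rewrite subrr mul0r exp0.
by rewrite -VE; apply: eq_specmx => i _; rewrite mul1r.
Qed.

Lemma lphi_posdef U d : U \is unitarymx -> antitone_below n d ->
  lphi k (specmx U (fun i => exp (d i))) = \sum_(i < k) d i.
Proof.
move=> uU anti_d; have pP : posdef (specmx U (fun i => exp (d i))) by exists U, d.
rewrite (@lphiE k _ U (fun i => 2 * d i)) //; first 1 last.
- exact: posdef_unit.
- by move=> i j ij jn; have := anti_d i j ij jn; lra.
- rewrite specmx_adj specmxM //; apply: eq_specmx => i _.
  by rewrite -expD; congr exp; lra.
by rewrite -mulr_sumr -mulrA double_half.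
Qed.

(** A factor [s >= 0] keeps the exponents in nonincreasing order, so the same [k] of them are
    counted. *)
Lemma lphi_mxpow P s : posdef P -> 0 <= s -> lphi k (mxpow P s) = s * lphi k P.
Proof.
move=> /posdef_sorted[U [d [uU anti_d ->]]] s_ge0.
rewrite mxpowE // !lphi_posdef //; first by rewrite mulr_sumr.
by move=> i j ij jn; rewrite ler_wpM2l // anti_d.
Qed.

Lemma lphi1 : lphi k 1%:M = 0.
Proof.
have p1 : posdef 1%:M.
  have := posdef_gram (unitmx1 K n); by rewrite adj1 mulmx1.
by rewrite -(mxpow0 p1) lphi_mxpow // mul0r.
Qed.

Lemma lphi_gram X : X \in unitmx -> lphi k (X ^t* *m X) = 2 * lphi k X.
Proof.
move=> uX; have [U [d [uU anti_d XU]]] := specmx_gram_exp uX.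
by rewrite (lphiE kn uX uU anti_d XU) XU lphi_posdef // double_half.
Qed.

(* Compare the [m]-th powers [Z^m = S Y^m S^-1], divide by [m] and let [m] grow. *)
Lemma lphi_similar Z S Y : posdef Z -> S \in unitmx -> Y \in unitmx ->
  Z *m S = S *m Y -> lphi k Z <= lphi k Y.
Proof.
(* [Y] is only assumed invertible, so its powers are iterated products rather than [mxpow]. *)
move=> pZ uS uY ZS; pose Yn m := iter m (mulmx Y) 1%:M.
have uYn m : Yn m \in unitmx.
  by elim: m => [|m IHm]; rewrite ?unitmx1 //= unitmx_mul uY.
have ZnS m : mxpow Z m%:R *m S = S *m Yn m.
  elim: m => [|m IHm]; first by rewrite mxpow0 // mul1mx mulmx1.
  by rewrite mulrS mxpowD // mxpow1 // -mulmxA IHm mulmxA ZS -mulmxA.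
have lYn m : lphi k (Yn m) <= m%:R * lphi k Y.
  elim: m => [|m IHm]; first by rewrite lphi1 mul0r.
  by rewrite (le_trans (lphiM uY (uYn m))) // mulrS mulrDl mul1r lerD2l.
have uSV : invmx S \in unitmx by rewrite unitmx_inv.
have bound m : m%:R * (lphi k Z - lphi k Y) <= lphi k S + lphi k (invmx S).
  have : lphi k (S *m Yn m *m invmx S) <= lphi k S + lphi k (Yn m) + lphi k (invmx S).
    have uSY : S *m Yn m \in unitmx by rewrite unitmx_mul uS uYn.
    by apply: le_trans (lphiM uSY uSV) _; rewrite lerD2r lphiM.
  by rewrite -ZnS mulmxK // lphi_mxpow // mulrBr; have := lYn m; lra.
rewrite leNgt -subr_gt0; apply/negP => gap.
set c := lphi k S + _ in bound.
have c_ge0 : 0 <= c by have := bound 0%N; rewrite mul0r.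
have := bound (Num.bound (c / (lphi k Z - lphi k Y))).
rewrite leNgt -ltr_pdivrMr // => /negP; apply.
by apply: archi_boundP; rewrite divr_ge0 // ltW.
Qed.

(* With [m = (s + u) / 2], [Q^m P^(2m) Q^m] is conjugate by [Q^(m - s)] to
   [(Q^s P^s) (P^u Q^u)]. *)
Lemma lphi_mxpow_mid P Q s u : posdef P -> posdef Q ->
  lphi k (mxpow P ((s + u) / 2) *m mxpow Q ((s + u) / 2)) <=
    (lphi k (mxpow P s *m mxpow Q s) + lphi k (mxpow P u *m mxpow Q u)) / 2.
Proof.
move=> pP pQ; set m := (s + u) / 2; pose X := mxpow P m *m mxpow Q m.
have uXs t : mxpow P t *m mxpow Q t \in unitmx by rewrite unitmx_mul !mxpow_unit.
have XX : X ^t* *m X = mxpow Q m *m mxpow P (s + u) *m mxpow Q m.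
  rewrite /X adjM !mxpow_adj // !mulmxA -(mulmxA (mxpow Q m)) -mxpowD //.
  by have -> : m + m = s + u by rewrite /m; lra.
have : lphi k (X ^t* *m X) <=
    lphi k ((mxpow P s *m mxpow Q s) ^t* *m (mxpow P u *m mxpow Q u)).
  apply: (@lphi_similar _ (mxpow Q (m - s))).
  - exact: (posdef_gram (uXs m)).
  - exact: mxpow_unit.
  - by rewrite unitmx_mul unitmx_adj !uXs.
  rewrite XX adjM !mxpow_adj // -(mulmxA _ (mxpow Q m)) -mxpowD //.
  rewrite !mulmxA -mxpowD // -(mulmxA (mxpow Q _) (mxpow P s)) -mxpowD //.
  have -> : m - s + s = m by lra.
  by have -> : m + (m - s) = u by rewrite /m; lra.
(* Passing to the Gram matrix doubles [lphi] on the left, which produces the mean on the right; the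
   adjoint does not change [lphi]. *)
have := lphiM (_ : (mxpow P s *m mxpow Q s) ^t* \in unitmx) (uXs u).
rewrite unitmx_adj uXs lphi_adj // /X (lphi_gram (uXs m)) => /(_ isT); lra.
Qed.

(** As a function of [s], the left-hand side is midpoint convex, vanishes at 0 and is bounded above
    on [[0, 1]] by submultiplicativity, so it stays below its chord. *)
Lemma lphi_cordes P Q s : posdef P -> posdef Q -> 0 <= s <= 1 ->
  lphi k (mxpow P s *m mxpow Q s) <= s * lphi k (P *m Q).
Proof.
move=> pP pQ s01.
have := @midconvex_le_chord (fun t => lphi k (mxpow P t *m mxpow Q t))
  (`|lphi k P| + `|lphi k Q|).
rewrite !mxpow1 //; apply=> //.
- by move=> t u; apply: lphi_mxpow_mid.
- by rewrite !mxpow0 // mulmx1 lphi1.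
move=> t /andP[t_ge0 t_le1].
rewrite (le_trans (lphiM _ _)) ?mxpow_unit // !lphi_mxpow //.
have bnd (x : R) : t * x <= `|x|.
  by rewrite (le_trans (ler_norm _)) // normrM ger0_norm // ler_piMl.
exact: lerD.
Qed.

End LogNorm.

(** * Determinants: the case [k = n] *)

Lemma det_gram_lphi X : X \in unitmx -> \det (X ^t* *m X) = rc (exp (2 * lphi n X)).
Proof.
move=> uX; have [U [d [uU anti_d XU]]] := specmx_gram_exp uX.
by rewrite (lphiE (leqnn n) uX uU anti_d XU) XU det_specmx // exp_sum double_half.
Qed.

Lemma lphi_mulmx X Y : X \in unitmx -> Y \in unitmx ->
  lphi n (X *m Y) = lphi n X + lphi n Y.
Proof.
move=> uX uY; have uXY : X *m Y \in unitmx by rewrite unitmx_mul uX.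
have rcexp_inj x y : rc (exp x) = rc (exp y) -> x = y.
  by move=> /fmorph_inj/exp_inv.
have : 2 * lphi n (X *m Y) = 2 * lphi n X + 2 * lphi n Y.
  apply: rcexp_inj; rewrite expD rmorphM -!det_gram_lphi //.
  by rewrite adjM !det_mulmx; ring.
lra.
Qed.

(** Negative exponents follow from [P^s P^(-s) = 1] and additivity; they occur in the mean and in
    the outer factors of the sandwich. *)
Lemma lphi_mxpow_real P s : posdef P -> lphi n (mxpow P s) = s * lphi n P.
Proof.
move=> pP; have [s_ge0|s_lt0] := lerP 0 s; first exact: lphi_mxpow.
have : lphi n (mxpow P s *m mxpow P (- s)) = 0.
  by rewrite -mxpowD // subrr mxpow0 // lphi1.
rewrite lphi_mulmx ?mxpow_unit // (@lphi_mxpow n _ P (- s)) ?oppr_ge0 ?ltW //.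
by rewrite mulNr => /eqP; rewrite subr_eq0 => /eqP.
Qed.

(** * The geometric mean and its comparison with the sandwiched product *)

Definition mxgmean_core P Q := mxpow P (- (1 / 2)) *m Q *m mxpow P (- (1 / 2)).

Definition mxgmean t P Q :=
  mxpow P (1 / 2) *m mxpow (mxgmean_core P Q) t *m mxpow P (1 / 2).

Lemma posdef_gmean_core P Q : posdef P -> posdef Q -> posdef (mxgmean_core P Q).
Proof.
move=> pP pQ; pose X := mxpow Q (1 / 2) *m mxpow P (- (1 / 2)).
have -> : mxgmean_core P Q = X ^t* *m X.
  rewrite /X adjM !mxpow_adj // mulmxA -(mulmxA (mxpow P _) (mxpow Q _)) -mxpowD //.
  by rewrite (_ : 1 / 2 + 1 / 2 = 1) ?mxpow1 //; lra.
by apply: posdef_gram; rewrite unitmx_mul !mxpow_unit.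
Qed.

Lemma gmean_coreK P Q : posdef P ->
  mxpow P (1 / 2) *m mxgmean_core P Q *m mxpow P (1 / 2) = Q.
Proof.
move=> pP; rewrite /mxgmean_core !mulmxA -mxpowD // -mulmxA -mxpowD //.
by rewrite subrr addNr mxpow0 // mul1mx mulmx1.
Qed.

Lemma lphi_sandwich_le_gmean k P Q t : (k <= n)%N ->
  posdef P -> posdef Q -> 1 <= t <= 2 ->
  lphi k (mxpow P ((1 - t) / 2) *m mxpow Q t *m mxpow P ((1 - t) / 2)) <=
    lphi k (mxgmean t P Q).
Proof.
move=> kn pP pQ t12; have pC := posdef_gmean_core pP pQ.
have QE := gmean_coreK Q pP; rewrite /mxgmean.
(* From here on [C] is any positive definite matrix with [P^(1/2) C P^(1/2) = Q]. *)
move: (mxgmean_core P Q) pC QE => C pC QE.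
set r := t - 1; pose X := mxpow P (1 / 2) *m mxpow C (t / 2).
pose Y := mxpow P (1 / 2) *m mxpow C (1 / 2); pose D := Y ^t* *m Y.
have uX : X \in unitmx by rewrite unitmx_mul !mxpow_unit.
have uY : Y \in unitmx by rewrite unitmx_mul !mxpow_unit.
have pD : posdef D by apply: posdef_gram.
have X_adj : X ^t* = mxpow C (t / 2) *m mxpow P (1 / 2) by rewrite adjM !mxpow_adj.
have Y_adj : Y ^t* = mxpow C (1 / 2) *m mxpow P (1 / 2) by rewrite adjM !mxpow_adj.
have half_split s : s / 2 + s / 2 = s by lra.
have -> : mxpow P (1 / 2) *m mxpow C t *m mxpow P (1 / 2) = (X ^t*) ^t* *m X ^t*.
  rewrite trmxCK X_adj -{1}(half_split t) mxpowD //.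
  by rewrite /X !mulmxA.
rewrite lphi_gram ?unitmx_adj // lphi_adj //.
have YY : Q = Y *m Y ^t*.
  have CC : C = mxpow C (1 / 2) *m mxpow C (1 / 2).
    by rewrite -mxpowD // half_split mxpow1.
  by rewrite Y_adj -QE {1}CC !mulmxA.
pose Z := mxpow D (r / 2) *m Y ^t* *m mxpow P ((1 - t) / 2).
have uZ : Z \in unitmx by rewrite !unitmx_mul unitmx_adj uY !mxpow_unit.
have -> : mxpow P ((1 - t) / 2) *m mxpow Q t *m mxpow P ((1 - t) / 2) = Z ^t* *m Z.
  rewrite YY mxpow_gram // -/D -/r -{1}(half_split r) mxpowD //.
  by rewrite /Z !adjM trmxCK !mxpow_adj // !mulmxA.
rewrite lphi_gram //.
(* The exponent 1/2 of [C] in [Z] splits as [r * (r / 2) + (1 - r) * (t / 2)], valid because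
   [t = 1 + r]; the two parts suit the Cordes exponents [r] and [1 - r]. *)
pose Z1 := mxpow D (r / 2) *m mxpow C (r * (r / 2)).
pose Z2 := mxpow C ((1 - r) * (t / 2)) *m mxpow P ((1 - r) / 2).
have uZ1 : Z1 \in unitmx by rewrite unitmx_mul !mxpow_unit.
have uZ2 : Z2 \in unitmx by rewrite unitmx_mul !mxpow_unit.
have ZE : Z = Z1 *m Z2.
  rewrite /Z1 /Z2 mulmxA -(mulmxA (mxpow D _)) -mxpowD // /Z Y_adj !mulmxA.
  rewrite -(mulmxA (mxpow D _ *m mxpow C _)) -mxpowD //.
  have -> : 1 / 2 + (1 - t) / 2 = (1 - r) / 2 by rewrite /r; field.
  by have -> : 1 / 2 = r * (r / 2) + (1 - r) * (t / 2) by rewrite /r; field.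
have Z1_le : lphi k Z1 <= r * lphi k X.
  have -> : Z1 = mxpow (mxpow D (1 / 2)) r *m mxpow (mxpow C (r / 2)) r.
    by rewrite !mxpowM // /Z1; congr (mxpow D _ *m mxpow C _); field.
  have pDh := posdef_mxpow (1 / 2) pD; have pCr := posdef_mxpow (r / 2) pC.
  (* The range [1 <= t <= 2] is what places both Cordes exponents [r] and [1 - r] in [[0, 1]]. *)
  have r01 : 0 <= r <= 1 by rewrite /r; lra.
  have uW : mxpow D (1 / 2) *m mxpow C (r / 2) \in unitmx.
    by rewrite unitmx_mul !mxpow_unit.
  (* Equal Gram matrices give equal singular values: both are [C^(t/2) P C^(t/2)], since
     [D = C^(1/2) P C^(1/2)] and [r + 1 = t]. *)
  have WW : (mxpow D (1 / 2) *m mxpow C (r / 2)) ^t* *m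
      (mxpow D (1 / 2) *m mxpow C (r / 2)) = X ^t* *m X.
    rewrite adjM !mxpow_adj // mulmxA -(mulmxA (mxpow C _)) -mxpowD // half_split mxpow1 //.
    rewrite /D Y_adj X_adj /X /Y !mulmxA -mxpowD // -(mulmxA _ (mxpow C _)) -mxpowD //.
    have -> : r / 2 + 1 / 2 = t / 2 by rewrite /r; field.
    by have -> : 1 / 2 + r / 2 = t / 2 by rewrite /r; field.
  have lphiW := lphi_gram kn uW; rewrite WW (lphi_gram kn uX) in lphiW.
  apply: le_trans (lphi_cordes kn pDh pCr r01) _.
  by apply: ler_wpM2l; [lra | lra].
have Z2_le : lphi k Z2 <= (1 - r) * lphi k X.
  have -> : Z2 = mxpow (mxpow C (t / 2)) (1 - r) *m mxpow (mxpow P (1 / 2)) (1 - r).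
    by rewrite !mxpowM // /Z2; congr (mxpow C _ *m mxpow P _); field.
  have pCt := posdef_mxpow (t / 2) pC; have pPh := posdef_mxpow (1 / 2) pP.
  have r01 : 0 <= 1 - r <= 1 by rewrite /r; lra.
  by apply: le_trans (lphi_cordes kn pCt pPh r01) _; rewrite -X_adj lphi_adj.
have := lphiM kn uZ1 uZ2; rewrite -ZE; lra.
Qed.

(** For [k = n], [lphi] is additive and homogeneous, and both sides come to
    [(1 - t) * lphi n P + t * lphi n Q]. *)
Lemma lphi_sandwich_eq_gmean P Q t : posdef P -> posdef Q ->
  lphi n (mxpow P ((1 - t) / 2) *m mxpow Q t *m mxpow P ((1 - t) / 2)) =
    lphi n (mxgmean t P Q).
Proof.
move=> pP pQ; have pC := posdef_gmean_core pP pQ.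
have uQ := posdef_unit pQ.
rewrite /mxgmean !lphi_mulmx ?unitmx_mul ?mxpow_unit // !lphi_mxpow_real //.
rewrite !lphi_mulmx ?unitmx_mul ?mxpow_unit ?uQ // !lphi_mxpow_real //.
by field.
Qed.

End SpectralCalculus.

(** * Translation to [Mat] *)

Local Open Scope complex_scope.

Definition CR : numClosedFieldType := R[i].

Definition rC : {rmorphism R -> CR} := real_complex R.

Lemma rC_embedding : real_embedding rC.
Proof.
split=> [x y|x|z /complex_realP //]; first exact: lecR.
exact: conjc_real.
Qed.

Local Notation specC := (specmx rC).

Definition mx_of n (A : Mat) : 'M[CR]_n := \matrix_(i, j) (re (A i j) +i* im (A i j)).

(** A right inverse of [mx_of], supplying witnesses for the [epsilon] choices. *)
Definition of_mx n (A : 'M[CR]_n) : Mat := fun i j =>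
  match (insub i : option 'I_n), (insub j : option 'I_n) with
  | Some i, Some j => mkC (complex.Re (A i j)) (complex.Im (A i j))
  | _, _ => C0
  end.

Definition cx (z : Defs.C) : CR := re z +i* im z.

Lemma cx_inj : injective cx.
Proof. by move=> [a b] [c d] [-> ->]. Qed.

Lemma cx_sum k f : cx (Csum k f) = \sum_(i < k) cx (f i).
Proof. by elim: k => [|k IHk]; rewrite ?big_ord0 // big_ord_recr -IHk. Qed.

Section Bridge.
Variable n : nat.
Implicit Types (A B H U : Mat) (d : nat -> R).

Lemma mx_ofE A i j : mx_of n A i j = cx (A i j).
Proof. by rewrite mxE. Qed.

Lemma of_mxK : cancel (@of_mx n) (mx_of n).
Proof.
by move=> M; apply/matrixP => i j; rewrite mxE /of_mx !valK; case: (M i j).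
Qed.

Lemma meqP A B : meq n A B <-> mx_of n A = mx_of n B.
Proof.
split=> [AB | AB i j /ssrnat.ltP i_n /ssrnat.ltP j_n].
  by apply/matrixP => i j; rewrite !mx_ofE AB //; apply/ssrnat.ltP.
by move/matrixP/(_ (Ordinal i_n) (Ordinal j_n)): AB; rewrite !mx_ofE => /cx_inj.
Qed.

Lemma mx_of_mul A B : mx_of n (mmul n A B) = mx_of n A *m mx_of n B.
Proof.
apply/matrixP => i j; rewrite mx_ofE cx_sum mxE.
by apply: eq_bigr => k _; rewrite !mx_ofE.
Qed.

Lemma mx_of_adj A : mx_of n (madj A) = (mx_of n A) ^t*.
Proof. by apply/matrixP => i j; rewrite !mxE. Qed.

Lemma mx_of_id : mx_of n mid = 1%:M.
Proof.
apply/matrixP => i j; rewrite mx_ofE mxE /mid -val_eqE /=.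
by case: PeanoNat.Nat.eqb_spec => [->|/eqP/negPf->]; rewrite ?eqxx.
Qed.

Lemma mx_of_diag d : mx_of n (mdiag d) = rdiag rC n d.
Proof.
apply/matrixP => i j; rewrite mx_ofE !mxE /mdiag -val_eqE /=.
by case: PeanoNat.Nat.eqb_spec => [->|/eqP/negPf->]; rewrite ?eqxx.
Qed.

Lemma mx_of_add A B : mx_of n (madd A B) = mx_of n A + mx_of n B.
Proof. by apply/matrixP => i j; rewrite !mxE. Qed.

Lemma mx_of_scale r A : mx_of n (mscale r A) = r%:C *: mx_of n A.
Proof. by apply/matrixP => i j; rewrite !mxE. Qed.

Lemma unitaryP U : unitary n U <-> mx_of n U \is unitarymx.
Proof.
rewrite /unitary meqP mx_of_mul mx_of_adj mx_of_id.
by split=> [/mulmx1C/unitarymxP | /unitarymxP/mulmx1C].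
Qed.

Lemma spectralP H U d :
  spectral n H U d <-> mx_of n U \is unitarymx /\ mx_of n H = specC (mx_of n U) d.
Proof. by rewrite /spectral unitaryP meqP !mx_of_mul mx_of_adj mx_of_diag. Qed.

(** The diagonalisation chosen by [epsilon] is unknown, but [specmx_fun_uniq] lets any other one
    compute the same matrix. *)
Lemma matfunE f H (V : 'M_n) d : V \is unitarymx -> mx_of n H = specC V d ->
  mx_of n (matfun n f H) = specC V (fun i => f (d i)).
Proof.
move=> uV HV; rewrite /matfun; set P := (fun p => spectral n H _ _).
have exP : exists p, P p.
  by exists (of_mx V, d); apply/spectralP; rewrite /= of_mxK.
have := epsilon_spec (inhabits (mzero, fun _ : nat => 0%R)) P exP.
case: (epsilon _ _) => [U e] /spectralP[uU HU].
rewrite !mx_of_mul mx_of_adj mx_of_diag; apply: (@specmx_fun_uniq _ rC) => //.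
by rewrite -HU.
Qed.

(** The spectrum chosen in [singvals] is sorted, so its prefix products agree with those of [d];
    positivity then moves the square root outside the product. *)
Lemma prod_singvals A (V : 'M_n) d k : (k <= n)%N -> V \is unitarymx ->
  antitone_below n d -> mx_of n A \in unitmx ->
  (mx_of n A) ^t* *m mx_of n A = specC V d ->
  Rprod k (singvals n A) = sqrt (\prod_(i < k) d i).
Proof.
move=> kn uV anti_d uA AV; rewrite /singvals; set P := (fun p => spectral n _ _ _ /\ _).
have exP : exists p, P p.
  exists (of_mx V, d); split.
    by apply/spectralP; rewrite mx_of_mul mx_of_adj /= of_mxK.
  by move=> i j /ssrnat.leP ij /ssrnat.ltP jn; apply/RleP/anti_d.
have := epsilon_spec (inhabits (mzero, fun _ : nat => 0%R)) P exP.
case: (epsilon _ _) => [U e] [/spectralP[/= uU]].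
rewrite mx_of_mul mx_of_adj => AU anti_e'.
have anti_e : antitone_below n e.
  by move=> i j ij jn; apply/RleP/anti_e'; [apply/ssrnat.leP | apply/ssrnat.ltP].
have d_gt0 := specmx_gram_gt0 rC_embedding uA uV AV.
have e_gt0 := specmx_gram_gt0 rC_embedding uA uU AU.
have -> : \prod_(i < k) d i = \prod_(i < k) e i.
  apply: (specmx_prefix_uniq rC_embedding kn uV uU _ anti_d _ anti_e); last by rewrite -AV -AU.
    by move=> i i_n; apply/ltW/d_gt0.
  by move=> i i_n; apply/ltW/e_gt0.
elim: k kn => [|k IHk] kn; first by rewrite big_ord0 /= sqrt_1.
rewrite big_ord_recr /= IHk ?(ltnW kn) // sqrt_mult //; last exact/RleP/ltW/e_gt0.
apply/RleP/prodr_ge0 => i _; apply/ltW/e_gt0/(leq_trans (ltn_ord i)).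
exact: ltnW.
Qed.

End Bridge.

(** * The exponential series of a Hermitian matrix *)

Definition exp_partial (x : R) N :=
  sum_f_R0 (fun k => Rmult (Rinv (INR (Factorial.fact k))) (pow x k)) N.

Lemma exp_partial_cv x : Un_cv (exp_partial x) (exp x).
Proof. by rewrite /exp; case: (exist_exp x) => l; exact. Qed.

Lemma Un_cv_ext f g l : f =1 g -> Un_cv f l -> Un_cv g l.
Proof. by move=> fg f_l eps /f_l[N fN]; exists N => m /fN; rewrite fg. Qed.

Lemma Un_cv_sum k (F : 'I_k -> nat -> R) l : (forall i, Un_cv (F i) (l i)) ->
  Un_cv (fun N => \sum_i F i N) (\sum_i l i).
Proof.
elim: k F l => [|k IHk] F l Fl.
  apply: (@Un_cv_ext (fun=> 0)) => [N|]; first by rewrite big_ord0.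
  rewrite big_ord0 => eps eps0; exists 0%N => m _.
  by rewrite /Rdist Rminus_diag Rabs_R0.
apply: (@Un_cv_ext (fun N => (\sum_(i < k) F (widen_ord (leqnSn k) i) N) + F ord_max N)).
  by move=> N; rewrite big_ord_recr.
by rewrite big_ord_recr; apply: CV_plus; [apply: IHk |].
Qed.

Section Exponential.
Variable n : nat.
Implicit Types (A : Mat) (U : 'M[CR]_n) (d e : nat -> R).

Lemma specCE U d i j :
  specC U d i j = \sum_l (U i l * (U j l)^*) * (d l)%:C.
Proof.
by rewrite /specmx mul_mx_diag !mxE; apply: eq_bigr => l _; rewrite !mxE mulrAC.
Qed.

(** Convergence in [mexp] is tested on real and imaginary parts; as the eigenvalues are real, each
    part is a real linear combination of them. *)
Lemma Re_specC U d i j :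
  complex.Re (specC U d i j) = \sum_l complex.Re (U i l * (U j l)^*) * d l.
Proof.
rewrite specCE (big_morph _ (id1 := 0) (op1 := +%R)) //; last by case=> ? ? [].
by apply: eq_bigr => l _; case: (U i l * (U j l)^*) => a b /=; rewrite mulr0 subr0.
Qed.

Lemma Im_specC U d i j :
  complex.Im (specC U d i j) = \sum_l complex.Im (U i l * (U j l)^*) * d l.
Proof.
rewrite specCE (big_morph _ (id1 := 0) (op1 := +%R)) //; last by case=> ? ? [].
by apply: eq_bigr => l _; case: (U i l * (U j l)^*) => a b /=; rewrite mulr0 add0r.
Qed.

Lemma mx_of_expsum A U d N : U \is unitarymx -> mx_of n A = specC U d ->
  mx_of n (expsum n A N) = specC U (fun i => exp_partial (d i) N).
Proof.
move=> uU AU.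
have powE k : mx_of n (mpow n A k) = specC U (fun i => pow (d i) k).
  elim: k => [|k IHk]; first by rewrite mx_of_id; apply: esym (specmx1 rC uU).
  rewrite mx_of_mul IHk AU; apply: etrans (specmxM rC _ _ uU) _.
  apply: eq_specmx => i _.
  by rewrite /= Rmult_comm.
elim: N => [|N IHN].
  rewrite mx_of_id; apply: etrans (esym (specmx1 rC uU)) _; apply: eq_specmx => i _.
  by rewrite /exp_partial /= Rinv_1 Rmult_1_l.
rewrite mx_of_add mx_of_scale IHN powE.
rewrite (specmxZ rC).
apply: etrans (specmxD rC _ _ _) _.
by apply: eq_specmx.
Qed.

(** Entries of the partial sums are fixed linear combinations of scalar exponential sums, hence
    converge; uniqueness of limits identifies the matrix chosen by [epsilon]. *)
Lemma mexpE A U d : U \is unitarymx -> mx_of n A = specC U d ->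
  mx_of n (mexp n A) = specC U (fun i => exp (d i)).
Proof.
move=> uU AU; rewrite /mexp; set P := (fun M : Mat => _).
set E := specC U _.
have cvRe (i j : 'I_n) : Un_cv (fun N => re (expsum n A N i j)) (complex.Re (E i j)).
  apply: (@Un_cv_ext (fun N => complex.Re (mx_of n (expsum n A N) i j))).
    by move=> N; rewrite mx_ofE.
  rewrite Re_specC; apply: (@Un_cv_ext (fun N => \sum_l
      complex.Re (U i l * (U j l)^*) * exp_partial (d l) N)).
    by move=> N; rewrite (mx_of_expsum _ uU AU) Re_specC.
  by apply: Un_cv_sum => l; apply: CV_mult; [move=> eps ?; exists 0%N => ? _;
    rewrite /Rdist Rminus_diag Rabs_R0 | apply: exp_partial_cv].
have cvIm (i j : 'I_n) : Un_cv (fun N => im (expsum n A N i j)) (complex.Im (E i j)).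
  apply: (@Un_cv_ext (fun N => complex.Im (mx_of n (expsum n A N) i j))).
    by move=> N; rewrite mx_ofE.
  rewrite Im_specC; apply: (@Un_cv_ext (fun N => \sum_l
      complex.Im (U i l * (U j l)^*) * exp_partial (d l) N)).
    by move=> N; rewrite (mx_of_expsum _ uU AU) Im_specC.
  by apply: Un_cv_sum => l; apply: CV_mult; [move=> eps ?; exists 0%N => ? _;
    rewrite /Rdist Rminus_diag Rabs_R0 | apply: exp_partial_cv].
have exP : exists M, P M.
  exists (of_mx E) => i j /ssrnat.ltP i_n /ssrnat.ltP j_n.
  by rewrite /of_mx !insubT /=; split; [apply: (cvRe (Ordinal i_n) (Ordinal j_n))
    | apply: (cvIm (Ordinal i_n) (Ordinal j_n))].
have PM := epsilon_spec (inhabits mzero) P exP.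
apply/matrixP => i j; rewrite mx_ofE.
have [reM imM] := PM i j (ssrnat.ltP (ltn_ord i)) (ssrnat.ltP (ltn_ord j)).
have := UL_sequence _ _ _ reM (cvRe i j); have := UL_sequence _ _ _ imM (cvIm i j).
by rewrite /cx => -> ->; case: (E i j).
Qed.

End Exponential.

(** * Exponentials, powers, means and singular values under [mx_of] *)

Section Translation.
Variable n : nat.
Implicit Types (A B H K : Mat) (s t : R) (U V : 'M[CR]_n) (d : nat -> R).

Lemma hermitian_specC H : Defs.hermitian n H ->
  exists U d, U \is unitarymx /\ mx_of n H = specC U d.
Proof.
rewrite /Defs.hermitian meqP mx_of_adj => hH.
by have [U [d [uU _ HU]]] := hermitian_specmx rC_embedding hH; exists U, d.
Qed.

Lemma posdef_mexp H : Defs.hermitian n H -> posdef rC (mx_of n (mexp n H)).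
Proof.
move=> /hermitian_specC[U [d [uU HU]]].
by exists U, d; split; [exact: uU | exact: mexpE uU HU].
Qed.

Lemma mexp_scale H s : Defs.hermitian n H ->
  mx_of n (mexp n (mscale s H)) = mxpow rC (mx_of n (mexp n H)) s.
Proof.
move=> /hermitian_specC[U [d [uU HU]]]; rewrite (mexpE uU HU).
have sHU : mx_of n (mscale s H) = specC U (fun i => s * d i).
  by rewrite mx_of_scale HU; apply: (specmxZ rC).
by rewrite (mexpE uU sHU); exact: (esym (mxpowE rC d s uU)).
Qed.

Lemma mx_of_mrpow A s : posdef rC (mx_of n A) ->
  mx_of n (mrpow n A s) = mxpow rC (mx_of n A) s.
Proof.
move=> [U [d [uU AU]]]; rewrite /mrpow (matfunE _ uU AU) AU.
apply: etrans (esym (mxpowE rC d s uU)).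
by apply: eq_specmx => i _; rewrite /Rpower ln_exp.
Qed.

Lemma mx_of_gmean A B t : posdef rC (mx_of n A) -> posdef rC (mx_of n B) ->
  mx_of n (gmean n t A B) = mxgmean rC t (mx_of n A) (mx_of n B).
Proof.
move=> pA pB; have halfE : Rdiv 1 2 = 1 / 2 :> R by rewrite RdivE.
have halfNE : Ropp (Rdiv 1 2) = - (1 / 2) :> R by rewrite halfE.
rewrite /gmean; move: (Ropp (Rdiv 1 2)) halfNE => _ ->.
move: (Rdiv 1 2) halfE => _ ->.
set core := mmul n (mmul n _ B) _.
have coreE : mx_of n core = mxgmean_core rC (mx_of n A) (mx_of n B).
  by rewrite 2!mx_of_mul (mx_of_mrpow (- (1 / 2)) pA) /mxgmean_core.
have pcore : posdef rC (mx_of n core).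
  by rewrite coreE; exact: (posdef_gmean_core rC_embedding pA pB).
rewrite 2!mx_of_mul (mx_of_mrpow _ pA) (mx_of_mrpow _ pcore) coreE /mxgmean.
reflexivity.
Qed.

(** The square root in [singvals] is the halving in [lphi]. *)
Lemma Rprod_singvals A k : (k <= n)%N -> mx_of n A \in unitmx ->
  Rprod k (singvals n A) = exp (lphi rC k (mx_of n A)).
Proof.
move=> kn uA; have [U [d [uU anti_d AU]]] := specmx_gram_exp rC_embedding uA.
rewrite (prod_singvals kn uU _ uA AU); last exact: antitone_exp.
by rewrite exp_sum sqrt_exp (lphiE rC_embedding kn uA uU anti_d AU).
Qed.

End Translation.

Local Close Scope complex_scope.
Local Close Scope sesquilinear_scope.
Local Close Scope ring_scope.
#[local] Bind Scope R_scope with R.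

(* Restores the meaning of [hermitian], shadowed by MathComp's form predicate. *)
Import Defs.
Local Open Scope R_scope.

Theorem theorem5 (n : nat) (H K : Mat) (t : R) :
  hermitian n H -> hermitian n K -> 1 <= t <= 2 ->
  logmaj n
    (mmul n (mmul n (mexp n (mscale ((1 - t) / 2) H)) (mexp n (mscale t K)))
            (mexp n (mscale ((1 - t) / 2) H)))
    (gmean n t (mexp n H) (mexp n K)).
Proof.
move=> hH hK [/RleP t_ge1 /RleP t_le2].
have pA := posdef_mexp hH; have pB := posdef_mexp hK.
have rE : (1 - t) / 2 = ((1 - t)%R / 2%R)%R :> R by rewrite RdivE.
set L := mmul n _ _; set G := gmean _ _ _ _.
have LE : mx_of n L = (mxpow rC (mx_of n (mexp n H)) ((1 - t) / 2)%R *m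
    mxpow rC (mx_of n (mexp n K)) t *m mxpow rC (mx_of n (mexp n H)) ((1 - t) / 2)%R)%R.
  by rewrite !mx_of_mul !mexp_scale // rE.
have GE : mx_of n G = mxgmean rC t (mx_of n (mexp n H)) (mx_of n (mexp n K)).
  exact: mx_of_gmean.
have uL : mx_of n L \in unitmx.
  by rewrite LE !unitmx_mul !mxpow_unit.
have uG : mx_of n G \in unitmx.
  rewrite GE !unitmx_mul !mxpow_unit //.
  exact: (posdef_gmean_core rC_embedding pA pB).
move: L G LE GE uL uG => L G LE GE uL uG.
split=> [k [_ /ssrnat.leP kn]|].
  rewrite (Rprod_singvals kn uL) (Rprod_singvals kn uG); apply/RleP.
  rewrite le_exp LE GE; apply: (lphi_sandwich_le_gmean rC_embedding kn pA pB).
  by rewrite t_ge1 t_le2.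
have lphi_eq : lphi rC n (mx_of n L) = lphi rC n (mx_of n G).
  by rewrite LE GE; apply: (lphi_sandwich_eq_gmean rC_embedding _ pA pB).
by rewrite (Rprod_singvals (leqnn n) uL) (Rprod_singvals (leqnn n) uG) lphi_eq.
Qed.
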